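(* Let $M_A$ be a full complex matrix algebra acting on a finite-dimensional Hilbert space, and let all cones below be cones of linear maps $M_A\to M_A$. The following statements are equivalent: (i) $\mathbb{PPT} \circ \mathbb{PPT} \subset \mathbb{SP}_1$. (ii) $\mathbb{PPT} \circ \mathbb P_1 \subset \mathbb{DEC}$. (iii) $\mathbb P_1 \circ \mathbb{PPT} \subset \mathbb{DEC}$. (iv) $\mathbb{PPT} \circ \mathbb{CP} \circ \mathbb{PPT} \subset \mathbb{SP}_1$. (v) $\mathbb{PPT} \circ \mathbb{DEC} \circ \mathbb{PPT} \subset \mathbb{SP}_1$. (vi) $\mathbb{PPT} \circ \mathbb P_1 \circ \mathbb{PPT} \subset \mathbb{CP}$. (vii) $\mathbb{PPT} \circ \mathbb P_1 \circ \mathbb{PPT} \subset \mathbb{PPT}$.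
   Context: For sets of linear maps on $M_A$, $K_1\circ K_2=\{\phi_1\circ\phi_2:\phi_1\in K_1,\phi_2\in K_2\}$ (and similarly for three factors). $\mathbb P_1$ is the cone of positive linear maps $M_A\to M_A$; $\mathbb{CP}$ the cone of completely positive maps; $\mathbb{CCP}=\{\phi\circ\mathrm t:\phi\in\mathbb{CP}\}$ the cone of completely copositive maps, with $\mathrm t$ the transpose map on $M_A$; $\mathbb{PPT}=\mathbb{CP}\cap\mathbb{CCP}$; $\mathbb{DEC}$ is the convex hull of $\mathbb{CP}\cup\mathbb{CCP}$ (decomposable maps). $\mathbb{SP}_1$ (superpositive, or entanglement-breaking, maps) is the cone of linear maps $\phi:M_A\to M_A$ whose Choi matrix $\mathrm C_\phi=\sum_{i,j}e_{ij}\otimes\phi(e_{ij})$ ($e_{ij}$ the matrix units of $M_A$) lies in the convex cone generated by all $|\xi\rangle\langle\xi|$ with $|\xi\rangle\in\mathbb C^A\otimes\mathbb C^A$ a product vector. *)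

(* Defs.v *)
From HB Require Import structures.
From mathcomp Require Import all_boot all_order all_algebra.
From mathcomp Require Import all_classical all_reals convex.
From mathcomp Require Import complex spectral.
(* Not imported: the notation [A ^t k] of [mxtens] clashes with [spectral]. *)
From mathcomp Require mxtens.

Set Implicit Arguments.
Unset Strict Implicit.
Unset Printing Implicit Defensive.

Import Order.TTheory GRing.Theory Num.Theory.
Local Open Scope classical_set_scope.
Local Open Scope ring_scope.
Local Open Scope sesquilinear_scope.
Local Open Scope complex_scope.

Notation "A *t B" := (mxtens.tensmx A B)
  (at level 40, left associativity, format "A  *t  B") : ring_scope.

(* Over [K = R[i]], [0 <= z] means that [z] is real and nonnegative, so the
   weights in both hulls are nonnegative reals. *)

Definition convex_hull (K : numDomainType) (V : lmodType K) (S : set V) :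
    set V :=
  smallest (@convex_set K V) S.

Definition convex_cone_hull (K : numDomainType) (V : lmodType K) (S : set V) :
    set V :=
  [set v | exists (k : nat) (w : 'I_k -> K) (s : 'I_k -> V),
     (forall i, 0 <= w i /\ S (s i)) /\ v = \sum_(i < k) w i *: s i].

Section Cones.
Variables (R : realType) (n : nat).
Local Notation C := R[i].
Local Notation M := 'M[C]_n.

Definition psdmx (m : nat) (X : 'M[C]_m) : Prop :=
  forall x : 'cV[C]_m, 0 <= (x ^t* *m X *m x) 0 0.

(* The block of [X : M_k (x) M_n] at the matrix unit [e_ij] of [M_k]. *)
Definition tens_block (k : nat) (X : 'M[C]_(k * n)) (i j : 'I_k) : M :=
  \matrix_(p, q) X (mxtens.mxtens_index (i, p)) (mxtens.mxtens_index (j, q)).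

(* [id_k (x) phi] on [M_k (x) M_n = 'M_(k * n)]. *)
Definition ampliation (phi : 'End(M)) (k : nat) (X : 'M[C]_(k * n)) :
    'M[C]_(k * n) :=
  \sum_(i < k) \sum_(j < k) delta_mx i j *t phi (tens_block X i j).

Definition choi (phi : 'End(M)) : 'M[C]_(n * n) :=
  \sum_(i < n) \sum_(j < n) delta_mx i j *t phi (delta_mx i j).

Definition transpose_map : 'End(M) := linfun (@trmx C n n).

Definition pos_maps : set 'End(M) :=
  [set phi | forall X : M, psdmx X -> psdmx (phi X)].

Definition cp_maps : set 'End(M) :=
  [set phi | forall (k : nat) (X : 'M[C]_(k * n)),
     psdmx X -> psdmx (ampliation phi X)].

Definition ccp_maps : set 'End(M) :=
  [set (phi \o transpose_map)%VF | phi in cp_maps].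

Definition ppt_maps : set 'End(M) := cp_maps `&` ccp_maps.

Definition dec_maps : set 'End(M) := convex_hull (cp_maps `|` ccp_maps).

(* Column vectors [x *t y : 'M_(n * n, 1 * 1)] are the product vectors. *)
Definition product_vector (xi : 'cV[C]_(n * n)) : Prop :=
  exists x y : 'cV[C]_n, xi = x *t y.

Definition sp1_maps : set 'End(M) :=
  [set phi | convex_cone_hull
     [set xi *m xi ^t* | xi in product_vector] (choi phi)].

Definition comp_maps (K1 K2 : set 'End(M)) : set 'End(M) :=
  [set (phi1 \o phi2)%VF | phi1 in K1 & phi2 in K2].

End Cones.

Arguments pos_maps : clear implicits.
Arguments cp_maps : clear implicits.
Arguments ccp_maps : clear implicits.
Arguments ppt_maps : clear implicits.
Arguments dec_maps : clear implicits.
Arguments sp1_maps : clear implicits.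

Notation "K1 ∘ K2" := (comp_maps K1 K2)
  (at level 40, left associativity) : classical_set_scope.

(* Main.v *)
(* The trace form (phi, psi) |-> Tr (phi \o psi) on the endomorphisms of M_A is
   cyclic.  For it P_1 and SP_1 are dual cones, as are DEC and PPT, and CP is
   self-dual.  By cyclicity each of the seven inclusions then amounts to
   Tr (phi \o chi \o psi) >= 0 for all phi, chi in PPT and psi in P_1, because
   PPT absorbs composition with CP and DEC on either side.

   The duality inclusions P_1^* in SP_1 and PPT^* in DEC need closed cones: both
   are generated by a compact set of hermitian matrices of trace 1, namely the
   projectors on unit product vectors, and the matrices |a><a| + (|b><b|)^Gamma
   with |a|^2 + |b|^2 = 1 and Gamma the partial transpose. *)
From HB Require Import structures.
Require Import Defs.
From mathcomp Require Import all_boot all_order all_algebra.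
From mathcomp Require Import all_classical all_reals all_analysis.
From mathcomp Require Import complex spectral ring lra.

Set Implicit Arguments.
Unset Strict Implicit.
Unset Printing Implicit Defensive.

Import Order.TTheory GRing.Theory Num.Theory.
Import numFieldNormedType.Exports.
Local Open Scope classical_set_scope.
Local Open Scope ring_scope.
Local Open Scope sesquilinear_scope.

(** * Duality for cones generated by a compact set *)

(** Separation is carried out over the reals, by projection on a nearest point, and complex matrices
    enter it only through a real encoding of the hermitian ones. Hermiticity of a Choi matrix must
    therefore be known before either hard duality inclusion applies. All compositions treated here
    are compositions of positive maps, whose Choi matrices are hermitian by polarization on product
    vectors. The trace normalization of the generators lets one linear functional read the total
    weight off a point of the cone. Bounding that weight by 1 truncates the cone to a compact set,
    on which a nearest point exists. *)

Lemma caratheodory_step (F : realFieldType) (m : nat)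
    (a : 'I_m.+1 -> 'rV[F]_m) (w : 'I_m.+1 -> F) : (forall i, 0 <= w i) ->
  exists i0 (w' : 'I_m.+1 -> F), [/\ forall i, 0 <= w' i, w' i0 = 0 &
    \sum_i w' i *: a i = \sum_i w i *: a i].
Proof.
move=> w_ge0; pose A := \matrix_i a i.
(* The m + 1 vectors live in dimension m, so they satisfy a dependency [u]; subtracting a multiple
   of [u] from the weights leaves the sum unchanged. *)
have: kermx A != 0.
  rewrite -mxrank_eq0 mxrank_ker subn_eq0 -ltnNge ltnS; exact: rank_leq_col.
case/rowV0Pn=> u /sub_kermxP uA0 u_neq0.
wlog [i1 ui1] : u uA0 u_neq0 / exists i, 0 < u 0 i.
  move=> wl; have [i ui] : exists i, u 0 i != 0.
    by apply/existsP; apply: contraR u_neq0 => /existsPn u0;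
      apply/eqP/rowP => i; rewrite mxE; apply/eqP; rewrite -[_ == _]negbK.
  case: (ltgtP 0 (u 0 i)) ui => // ui _; first by apply: (wl u) => //; exists i.
  apply: (wl (- u)); rewrite ?mulNmx ?uA0 ?oppr0 ?oppr_eq0 //.
  by exists i; rewrite mxE oppr_gt0.
case: (@Order.TotalTheory.arg_minP _ _ _ i1 (fun i => 0 < u 0 i)
        (fun i => w i / u 0 i) ui1) => i0 ui0 min_i0.
(* The minimal ratio is the largest multiple of [u] that keeps all weights nonnegative, and it
   cancels the weight at [i0]. *)
pose t := w i0 / u 0 i0.
have t_ge0 : 0 <= t by rewrite divr_ge0 // ltW.
exists i0, (fun i => w i - t * u 0 i); split.
- move=> i; rewrite subr_ge0; have [ui|ui] := ltP 0 (u 0 i).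
    by rewrite -ler_pdivlMr //; exact: min_i0.
  by rewrite (le_trans _ (w_ge0 i)) // mulr_ge0_le0.
- by rewrite /t divfK ?subrr // gt_eqF.
- under eq_bigr do rewrite scalerBl -scalerA.
  rewrite sumrB -scaler_sumr.
  have -> : \sum_i u 0 i *: a i = u *m A.
    by rewrite mulmx_sum_row; apply: eq_bigr => i _; rewrite rowK.
  by rewrite uA0 scaler0 subr0.
Qed.

(** The shorter family reuses the given points, so any constraint on the points survives the
    reduction. *)
Lemma caratheodory_lift (F : realFieldType) (P : Type) (m : nat)
    (h : P -> 'rV[F]_m) (w : 'I_m.+1 -> F) (s : 'I_m.+1 -> P) :
  (forall i, 0 <= w i) ->
  exists (w' : 'I_m -> F) (s' : 'I_m -> P), [/\ forall i, 0 <= w' i,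
    forall i, exists j, s' i = s j &
    \sum_i w' i *: h (s' i) = \sum_i w i *: h (s i)].
Proof.
move=> /(caratheodory_step (h \o s))[i0 [w' [w'_ge0 w'0 <-]]].
exists (w' \o lift i0), (s \o lift i0); split=> //= [i|].
  by exists (lift i0 i).
by rewrite [RHS](bigD1_ord i0) //= w'0 scale0r add0r.
Qed.

Definition dot (F : comPzRingType) (m : nat) (u v : 'rV[F]_m) : F :=
  \sum_j u 0 j * v 0 j.

Section Dot.
Variables (F : comPzRingType) (m : nat).
Implicit Types u v : 'rV[F]_m.

Lemma dotC u v : dot u v = dot v u.
Proof. by apply: eq_bigr => j _; rewrite mulrC. Qed.

Lemma dotDr u v w : dot u (v + w) = dot u v + dot u w.
Proof. by rewrite -big_split; apply: eq_bigr => j _; rewrite mxE mulrDr. Qed.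

Lemma dotZr u a v : dot u (a *: v) = a * dot u v.
Proof. by rewrite mulr_sumr; apply: eq_bigr => j _; rewrite mxE mulrCA. Qed.

Lemma dot0r u : dot u 0 = 0.
Proof. by rewrite /dot big1 // => j _; rewrite mxE mulr0. Qed.

Lemma dotNr u v : dot u (- v) = - dot u v.
Proof. by rewrite -scaleN1r dotZr mulN1r. Qed.

Lemma dot_sumr u (I : Type) (r : seq I) (f : I -> 'rV[F]_m) :
  dot u (\sum_(i <- r) f i) = \sum_(i <- r) dot u (f i).
Proof.
by elim/big_ind2: _ => [|x ? y ? <- <-|//]; rewrite ?dot0r ?dotDr.
Qed.

End Dot.

Lemma dot_eq0 (F : realDomainType) m (u : 'rV[F]_m) : dot u u <= 0 -> u = 0.
Proof.
move=> u0; apply/rowP => j; rewrite mxE; apply/eqP; rewrite -sqrf_eq0 expr2.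
have /eqP : dot u u = 0.
  by apply/le_anti; rewrite u0 sumr_ge0 // => i _; exact: sqr_ge0.
rewrite psumr_eq0 => [|i _]; last exact: sqr_ge0.
by move=> /allP /(_ j); rewrite mem_index_enum => /(_ isT).
Qed.

Section RealContinuity.
Variables (R : realType) (T : topologicalType).

Lemma continuous_sumr (I : Type) (r : seq I) (f : I -> T -> R) :
  (forall i, continuous (f i)) -> continuous (fun x => \sum_(i <- r) f i x).
Proof.
move=> fc x; elim: r => [|i r IH].
  have -> : (fun y => \sum_(i <- [::]) f i y) = cst 0.
    by apply/funext => y; rewrite big_nil.
  exact: cst_continuous.
have -> : (fun y => \sum_(i <- i :: r) f i y) =
    f i \+ (fun y => \sum_(i <- r) f i y).
  by apply/funext => y; rewrite big_cons.
by apply: continuousD; [exact: fc|exact: IH].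
Qed.

Lemma compact_sublevel (K : set T) (f : T -> R) (c : R) :
  compact K -> continuous f -> compact (K `&` [set x | f x <= c]).
Proof.
move=> cK cf; apply: compact_closedI => //.
have := proj1 (continuous_closedP f) cf [set y | y <= c].
by apply; exact: closed_le.
Qed.

End RealContinuity.

(* Caratheodory's theorem keeps the cone generated by h(K) inside the image of
   the compact set of m-tuples of weighted points of K; one reduction step is
   enough, as the competitors only need m + 1 points. *)
Lemma cone_nearest_point (R : realType) (P : topologicalType) (m : nat)
    (K : set P) (h : P -> 'rV[R]_m) (tau x : 'rV[R]_m) :
  K !=set0 -> compact K -> (forall j, continuous (fun p => h p 0 j)) ->
  (forall p, K p -> dot tau (h p) = 1) ->
  exists c, (exists (w : 'I_m -> R) (s : 'I_m -> P),
      [/\ forall i, 0 <= w i, forall i, K (s i),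
       c = \sum_i w i *: h (s i) & \sum_i w i <= 1]) /\
   forall (w : 'I_m.+1 -> R) (s : 'I_m.+1 -> P),
    (forall i, 0 <= w i) -> (forall i, K (s i)) -> \sum_i w i <= 1 ->
    dot (x - c) (x - c) <=
    dot (x - \sum_i w i *: h (s i)) (x - \sum_i w i *: h (s i)).
Proof.
move=> [p0 Kp0] cK hc h1.
pose T := prod_topology (fun _ : 'I_m => (R * P)%type).
pose A : set T := [set q | forall i, (`[0, 1]%classic `*` K) (q i)].
have cA : compact A.
  have := @tychonoff 'I_m (fun _ => (R * P)%type)
    (fun _ => `[0, 1]%classic `*` K).
  apply => i; apply: compact_setX => //.
  exact: segment_compact.
pose tot (q : T) : R := \sum_i (q i).1.
pose pt (q : T) := \sum_i (q i).1 *: h (q i).2.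
have projc i : continuous (fun q : T => q i).
  exact: (@proj_continuous _ (fun _ => (R * P)%type) i).
have c1 i : continuous (fun q : T => (q i).1).
  by move=> q; apply: continuous_comp; [exact: projc|exact: cvg_fst].
have c2 i j : continuous (fun q : T => h (q i).2 0 j).
  move=> q; apply: (@continuous_comp _ _ _ (fun q : T => (q i).2)
    (fun p => h p 0 j)); last exact: hc.
  by apply: continuous_comp; [exact: projc|exact: cvg_snd].
pose g q := dot (x - pt q) (x - pt q).
have cg : continuous g.
  have cd j : continuous (fun q => (x - pt q) 0 j).
    have -> : (fun q => (x - pt q) 0 j) =
        cst (x 0 j) - (fun q => \sum_i (q i).1 * h (q i).2 0 j).
      by apply/funext => q; rewrite !mxE summxE; under eq_bigr do rewrite mxE.
    move=> q; apply: continuousB; first exact: cst_continuous.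
    apply: continuous_sumr => i q'.
    exact: (continuousM (c1 i q') (c2 i j q')).
  by apply: continuous_sumr => j q; exact: (continuousM (cd j q) (cd j q)).
pose B := A `&` [set q | tot q <= 1].
have cB : compact B by apply: compact_sublevel => //; exact: continuous_sumr.
have B0 : B !=set0.
  exists (fun=> (0, p0)); split => [i /=|]; first by rewrite in_itv /= lexx ler01.
  by rewrite /= /tot big1.
have [q] := compact_EVT_min B0 cB (continuous_subspaceT cg).
rewrite inE => -[Aq totq] minq; exists (pt q); split.
  exists (fun i => (q i).1), (fun i => (q i).2); split => // i;
    have [/= + ?] := Aq i => //.
  by rewrite in_itv => /andP[].
move=> w s w_ge0 Ks sw.
have [w' [s' [w'_ge0 s's eqs]]] := caratheodory_lift h s w_ge0.
have Ks' i : K (s' i) by have [j ->] := s's i.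
(* Since [tau] reads the total weight off the sum, the reduction to m points preserves the bound
   1. *)
have tots k (v : 'I_k -> R) (r : 'I_k -> P) : (forall i, K (r i)) ->
    dot tau (\sum_i v i *: h (r i)) = \sum_i v i.
  by move=> Kr; rewrite dot_sumr; apply: eq_bigr => i _; rewrite dotZr h1 ?mulr1.
have w'1 : \sum_i w' i <= 1 by rewrite -(tots _ _ s') // eqs tots.
rewrite -eqs; apply: (minq (fun i => (w' i, s' i))).
rewrite inE; split => // i; split => //=.
rewrite in_itv /= w'_ge0 /= (le_trans _ w'1) //.
by rewrite (bigD1 i) //= lerDl sumr_ge0.
Qed.

(** The squared length of y - t v has derivative -2 (y.v) at t = 0, so y.v > 0 would let a small
    step decrease it. *)
Lemma dot_le0_of_min (R : realFieldType) (m : nat) (y v : 'rV[R]_m) :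
  (forall t, 0 < t -> t <= 1 -> dot y y <= dot (y - t *: v) (y - t *: v)) ->
  dot y v <= 0.
Proof.
move=> min_y; rewrite leNgt; apply/negP => yv0.
have v0 : 0 <= dot v v by apply: sumr_ge0 => i _; exact: sqr_ge0.
(* The quadratic is minimal at (y.v) / (v.v); adding y.v to the denominator makes it visibly
   positive and keeps t at most 1. *)
pose t := dot y v / (dot y v + dot v v).
have den0 : 0 < dot y v + dot v v by rewrite ltr_wpDr.
have t0 : 0 < t by rewrite divr_gt0.
have := min_y t t0; rewrite ler_pdivrMr // mul1r lerDl => /(_ v0).
rewrite !(dotC (y - _)) !(dotDr, dotNr, dotZr) !(dotC (_ - _)).
rewrite !(dotDr, dotNr, dotZr) (dotC v y).
have : t * (dot y v + dot v v) = dot y v by rewrite divfK // gt_eqF.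
move: (dot y v) (dot v v) (dot y y) => a b c in yv0 v0 den0 *.
move=> tab le; suff : t * (2 * a - t * b) <= 0.
  rewrite pmulr_rle0 //; nra.
nra.
Qed.

(** Scale x so that tau.x <= 1, let c be its nearest point in the truncated cone and y = x - c.
    Minimality gives y.c >= 0 and y.h(p) <= y.c, so (y.c) tau - y is nonnegative on the generators,
    while its value at x is at most -|y|^2. Hence y = 0. *)
Lemma cone_bipolar (R : realType) (P : topologicalType) (m : nat)
    (K : set P) (h : P -> 'rV[R]_m) (tau x : 'rV[R]_m) :
  compact K -> (forall j, continuous (fun p => h p 0 j)) ->
  (forall p, K p -> dot tau (h p) = 1) ->
  (forall f, (forall p, K p -> 0 <= dot f (h p)) -> 0 <= dot f x) ->
  exists (k : nat) (w : 'I_k -> R) (s : 'I_k -> P),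
    (forall i, 0 <= w i /\ K (s i)) /\ x = \sum_i w i *: h (s i).
Proof.
move=> cK hc h1 xdual; have [K0|/eqP /set0P K0] := pselect (K = set0).
  exists 0%N, (fun=> 0), (fun i : 'I_0 => False_rect _ (notF (ltn_ord i))).
  split; first by case.
  (* When K is empty every functional is admissible, and -x gives |x|^2 <= 0. *)
  rewrite big_ord0; apply: dot_eq0; rewrite -oppr_ge0 -dotNr dotC.
  by apply: xdual => p; rewrite K0.
pose B := `|dot tau x| + 1.
have B0 : 0 < B by rewrite ltr_wpDl.
pose x1 := B^-1 *: x.
have [c [[w [s [w0 Ks cE w1]]] minc]] := cone_nearest_point x1 K0 cK hc h1.
set y := x1 - c in minc.
(* The competitor c + t (e h(p) - c) uses one point more than c. Below, e = 0 moves c towards the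
   apex and e = 1 towards h(p). *)
have side e p : 0 <= e <= 1 -> K p -> dot y (e *: h p - c) <= 0.
  move=> /andP[e0 e1] Kp; apply: dot_le0_of_min => t t0 t1.
  pose w' i := if unlift ord0 i is Some j then (1 - t) * w j else t * e.
  pose s' i := if unlift ord0 i is Some j then s j else p.
  have sumE : \sum_i w' i = t * e + (1 - t) * \sum_i w i.
    rewrite big_ord_recl /w' unlift_none mulr_sumr.
    by congr (_ + _); apply: eq_bigr => i _; rewrite liftK.
  have ptE : \sum_i w' i *: h (s' i) = (t * e) *: h p + (1 - t) *: c.
    rewrite big_ord_recl /w' /s' unlift_none cE scaler_sumr.
    by congr (_ + _); apply: eq_bigr => i _; rewrite liftK scalerA.
  have := minc w' s'; rewrite sumE ptE.
  have -> : x1 - ((t * e) *: h p + (1 - t) *: c) = y - t *: (e *: h p - c).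
    by apply/rowP => j; rewrite !mxE; ring.
  apply=> [i|i|].
  - by rewrite /w'; case: unliftP => [j|] _; rewrite mulr_ge0 ?subr_ge0 // ltW.
  - by rewrite /s'; case: unliftP.
  - have : \sum_i w i <= 1 := w1; move: (\sum_i w i) => W W1; nra.
have [p0 Kp0] := K0.
have yc : 0 <= dot y c.
  have := side 0 p0; rewrite lexx ler01 scale0r add0r dotNr oppr_le0.
  by move=> /(_ isT Kp0).
have yh p : K p -> dot y (h p) <= dot y c.
  move=> Kp; have := side 1 p.
  by rewrite lexx ler01 scale1r dotDr dotNr subr_le0; apply.
(* Tested on x1 = y + c, this functional gives |y|^2 <= 0. *)
have : 0 <= dot (dot y c *: tau - y) x.
  apply: xdual => p Kp; rewrite dotC dotDr dotNr dotZr !(dotC (h p)) h1 // mulr1.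
  by rewrite subr_ge0 yh.
have -> : x = B *: x1 by rewrite scalerA divff ?scale1r // gt_eqF.
rewrite dotZr pmulr_rge0 // dotC dotDr dotNr dotZr subr_ge0 !(dotC x1) => le.
have xE : x1 = y + c by rewrite subrK.
have tx : dot tau x1 <= 1.
  rewrite dotZr mulrC ler_pdivrMr // mul1r /B.
  by rewrite (le_trans (ler_norm _)) // lerDl.
have y0 : y = 0.
  apply: dot_eq0; move: le; rewrite {1}xE dotDr => le.
  have : dot y c * dot tau x1 <= dot y c by rewrite ler_piMr.
  lra.
exists m, (fun i => B * w i), s; split=> [i|]; first by rewrite mulr_ge0 // ltW.
by rewrite xE y0 add0r cE scaler_sumr; apply: eq_bigr => i _; rewrite scalerA.
Qed.

(** Over a commutative ring this is Tr (A^T B): bilinear, with no conjugation. *)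
Definition pairmx (F : pzRingType) (m : nat) (A B : 'M[F]_m) : F :=
  \sum_i \sum_j A i j * B i j.

Lemma dot_mxvec (F : comPzRingType) (m : nat) (A B : 'M[F]_m) :
  dot (mxvec A) (mxvec B) = pairmx A B.
Proof.
rewrite /dot /pairmx pair_bigA (reindex _ (curry_mxvec_bij m m)) /=.
by apply: eq_bigr => -[i j] _; rewrite /= !mxvecE.
Qed.

Section HermitianCone.
Variable R : realType.
Local Notation C := R[i].

Lemma conjCE (z : C) : z^* = Complex (complex.Re z) (- complex.Im z).
Proof. by case: z. Qed.

(* A hermitian matrix is encoded by the real matrix of the Re X_ij + Im X_ij,
   which is isometric because Re X is symmetric and Im X antisymmetric.  With
   a = (1 - i) / 2 the encoding is a X_ij + a^* X_ji, and it is inverted by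
   X_ij = a^* E_ij + a E_ji. *)
Let a : C := Complex 2^-1 (- 2^-1).

Definition herm_enc (N : nat) (X : 'M[C]_N) : 'M[R]_N :=
  \matrix_(i, j) (complex.Re (X i j) + complex.Im (X i j)).

Definition herm_dec (N : nat) (E : 'M[R]_N) : 'M[C]_N :=
  \matrix_(i, j) (a^* * (E i j)%:C%C + a * (E j i)%:C%C).

Lemma herm_encK (N : nat) (X : 'M[C]_N) :
  X^t* = X -> herm_dec (herm_enc X) = X.
Proof.
move=> hX; apply/matrixP => i j; rewrite !mxE.
have -> : X j i = (X i j)^* by rewrite -{1}hX !mxE.
rewrite !conjCE; case: (X i j) => x y /=.
by apply/eqP; rewrite eq_complex /=; apply/andP; split; apply/eqP; field.
Qed.

(** Besides inverting the encoding, [herm_dec] is its adjoint up to transposition; this turns each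
    real functional on encodings into a complex pairing. *)
Lemma pairmx_herm_enc (N : nat) (E : 'M[R]_N) (X : 'M[C]_N) : X^t* = X ->
  pairmx (herm_dec E)^T X = (pairmx E (herm_enc X))%:C%C.
Proof.
move=> hX; rewrite /pairmx.
under eq_bigr do under eq_bigr do rewrite !mxE mulrDl.
under eq_bigr do rewrite big_split /=.
rewrite big_split /= exchange_big /= -big_split rmorph_sum.
apply: eq_bigr => i _ /=; rewrite -big_split rmorph_sum.
apply: eq_bigr => j _ /=; rewrite mxE.
have -> : X j i = (X i j)^* by rewrite -{1}hX !mxE.
rewrite !conjCE; case: (X i j) => x y /=.
by apply/eqP; rewrite eq_complex /=; apply/andP; split; apply/eqP; field.
Qed.

Lemma hermitian_cone_bipolar (P : topologicalType) (N : nat) (K : set P)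
    (h : P -> 'M[C]_N) (X : 'M[C]_N) :
  compact K ->
  (forall i j, continuous (fun p => complex.Re (h p i j))) ->
  (forall i j, continuous (fun p => complex.Im (h p i j))) ->
  (forall p, (h p)^t* = h p) -> (forall p, K p -> \tr (h p) = 1) ->
  X^t* = X ->
  (forall H, (forall p, K p -> 0 <= pairmx H (h p)) -> 0 <= pairmx H X) ->
  exists (k : nat) (w : 'I_k -> C) (s : 'I_k -> P),
    (forall i, 0 <= w i /\ K (s i)) /\ X = \sum_i w i *: h (s i).
Proof.
move=> cK cRe cIm hherm htr hX Xdual.
(* The normalizing functional is the identity matrix: on an encoding it gives Re Tr + Im Tr, which
   is 1 on the generators. *)
have [||f fpos|k [w [s [wKs XE]]]] := @cone_bipolar R P _ K
    (fun p => mxvec (herm_enc (h p))) (mxvec 1%:M) (mxvec (herm_enc X)) cK.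
- move=> k; case/mxvec_indexP: k => i j.
  have -> : (fun p => mxvec (herm_enc (h p)) 0 (mxvec_index i j)) =
      (fun p => complex.Re (h p i j)) + (fun p => complex.Im (h p i j)).
    by apply/funext => p; rewrite mxvecE mxE.
  by move=> p; apply: continuousD; [exact: cRe|exact: cIm].
- move=> p Kp; rewrite dot_mxvec /pairmx.
  have trE : \tr (h p) = Complex (\sum_i complex.Re (h p i i))
      (\sum_i complex.Im (h p i i)).
    rewrite /mxtrace; elim/big_rec3: _ => //= i x y z _ ->.
    by case: (h p i i).
  have [re im] : \sum_i complex.Re (h p i i) = 1 /\
      \sum_i complex.Im (h p i i) = 0.
    by have := htr p Kp; rewrite trE => -[].
  transitivity (\sum_i complex.Re (h p i i) + \sum_i complex.Im (h p i i)).
    rewrite -big_split /=.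
    apply: eq_bigr => i _; rewrite (bigD1 i) //= big1 ?addr0 => [|j ij].
      by rewrite !mxE eqxx mul1r.
    by rewrite mxE eq_sym (negPf ij) mul0r.
  by rewrite re im addr0.
- rewrite -(vec_mxK f) dot_mxvec -ler0c -pairmx_herm_enc //.
  apply: Xdual => p Kp; rewrite pairmx_herm_enc // ler0c -dot_mxvec vec_mxK.
  exact: fpos.
exists k, (fun i => (w i)%:C%C), s; split=> [i|].
  by rewrite ler0c; have [] := wKs i.
rewrite -{1}(herm_encK hX); apply/matrixP => i j.
have encE u v : herm_enc X u v = \sum_l w l * herm_enc (h (s l)) u v.
  rewrite -mxvecE XE summxE; apply: eq_bigr => l _.
  by rewrite mxE mxvecE.
rewrite mxE !encE !rmorph_sum !mulr_sumr -big_split summxE.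
apply: eq_bigr => l _; rewrite [RHS]mxE.
have /matrixP /(_ i j) <- := herm_encK (hherm (s l)).
by rewrite [in RHS]mxE !rmorphM /=; ring.
Qed.

End HermitianCone.

(** * Positive semidefinite matrices *)

Definition rank1 (F : numClosedFieldType) (m : nat) (x : 'cV[F]_m) : 'M[F]_m :=
  x *m x^t*.

Section PairMx.
Variables (F : comPzRingType) (m : nat).
Implicit Types A B : 'M[F]_m.

Lemma pairmxC A B : pairmx A B = pairmx B A.
Proof. by apply: eq_bigr => i _; apply: eq_bigr => j _; rewrite mulrC. Qed.

Lemma pairmxDr A B B' : pairmx A (B + B') = pairmx A B + pairmx A B'.
Proof.
rewrite -big_split; apply: eq_bigr => i _; rewrite -big_split.
by apply: eq_bigr => j _; rewrite mxE mulrDr.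
Qed.

Lemma pairmxZr A c B : pairmx A (c *: B) = c * pairmx A B.
Proof.
rewrite mulr_sumr; apply: eq_bigr => i _; rewrite mulr_sumr.
by apply: eq_bigr => j _; rewrite mxE mulrCA.
Qed.

Lemma pairmx0r A : pairmx A 0 = 0.
Proof. by rewrite -[X in pairmx _ X](scale0r 0) pairmxZr mul0r. Qed.

Lemma pairmx_sumr A (I : Type) (r : seq I) (f : I -> 'M[F]_m) :
  pairmx A (\sum_(i <- r) f i) = \sum_(i <- r) pairmx A (f i).
Proof.
by elim/big_ind2: _ => [|x ? y ? <- <-|//]; rewrite ?pairmx0r ?pairmxDr.
Qed.

Lemma pairmx_trmx A B : pairmx A^T B = pairmx A B^T.
Proof.
rewrite /pairmx exchange_big; apply: eq_bigr => i _; apply: eq_bigr => j _.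
by rewrite !mxE.
Qed.

Lemma pairmx_delta A i j : pairmx A (delta_mx i j) = A i j.
Proof.
rewrite /pairmx (bigD1 i) //= (bigD1 j) //= mxE !eqxx mulr1 !big1 ?addr0 //.
  by move=> k ki; rewrite big1 // => l _; rewrite mxE (negPf ki) mulr0.
by move=> k kj; rewrite mxE (negPf kj) andbF mulr0.
Qed.

End PairMx.

Section Psd.
Variable R : realType.
Local Notation C := R[i].

Lemma rank1E (m : nat) (x : 'cV[C]_m) i j : rank1 x i j = x i 0 * (x j 0)^*.
Proof. by rewrite mxE big_ord1 !mxE. Qed.

Lemma rank1Z (m : nat) (c : C) (x : 'cV[C]_m) :
  rank1 (c *: x) = (c * c^*) *: rank1 x.
Proof. by apply/matrixP => i j; rewrite !(rank1E, mxE) rmorphM /=; ring. Qed.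

Lemma rank1_0 (m : nat) : rank1 (0 : 'cV[C]_m) = 0.
Proof. by rewrite /rank1 mul0mx. Qed.

Lemma rank1_herm (m : nat) (x : 'cV[C]_m) : (rank1 x)^t* = rank1 x.
Proof.
by apply/matrixP => i j; rewrite !(rank1E, mxE) rmorphM /= conjCK mulrC.
Qed.

Lemma rank1_trmx (m : nat) (x : 'cV[C]_m) :
  (rank1 x)^T = rank1 (map_mx Num.conj x).
Proof. by apply/matrixP => i j; rewrite !(rank1E, mxE) conjCK mulrC. Qed.

(** The value of the form at x is the pairing with the rank-one matrix of the conjugate of x, and
    conjugation permutes the vectors. *)
Lemma psdmxP (m : nat) (A : 'M[C]_m) :
  psdmx A <-> forall x, 0 <= pairmx A (rank1 x).
Proof.
have formE x : (x^t* *m A *m x) 0 0 = pairmx A (rank1 (map_mx Num.conj x)).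
  rewrite mxE /pairmx exchange_big; apply: eq_bigr => j _.
  rewrite mxE mulr_suml; apply: eq_bigr => i _.
  by rewrite rank1E !mxE conjCK; ring.
split=> psdA x; last by rewrite formE.
by rewrite -[x]map_mxCK -formE; exact: psdA.
Qed.

(** Polarization on e_i + c e_j: c = 0 kills the diagonal, c = i gives A_ij = A_ji, and c = 1 gives
    A_ij = -A_ji. *)
Lemma sesqui_eq0 (m : nat) (A : 'M[C]_m) :
  (forall x, pairmx A (rank1 x) = 0) -> A = 0.
Proof.
move=> A0.
have rank1D (c : C) i j : pairmx A (rank1 (delta_mx i 0 + c *: delta_mx j 0)) =
    A i i + c^* * A i j + c * A j i + c * c^* * A j j.
  have -> : rank1 (delta_mx i 0 + c *: delta_mx j 0) =
     delta_mx i i + c^* *: delta_mx i j + c *: delta_mx j i +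
     (c * c^*) *: delta_mx j j :> 'M[C]_m.
    apply/matrixP => k l; rewrite rank1E !mxE !andbT rmorphD rmorphM /= !conjC_nat.
    by case: (k == i); case: (k == j); case: (l == i); case: (l == j) => /=; ring.
  by rewrite !(pairmxDr, pairmxZr) !pairmx_delta.
have diag i : A i i = 0.
  have := rank1D 0 i i; rewrite A0 conjC0 !mul0r !addr0 => <- //.
apply/matrixP => i j; rewrite mxE.
have := rank1D 1 i j; have := rank1D 'i i j.
rewrite !A0 conjCi conjC1 !diag !mulr0 !add0r !addr0 !mul1r mulNr.
move=> /esym e1 /esym e2.
have {}e1 : A j i = A i j.
  apply: (mulfI (neq0Ci C)); apply/eqP; rewrite -subr_eq0 addrC; exact/eqP.
by move/eqP: e2; rewrite e1 -mulr2n mulrn_eq0 => /orP[|/eqP].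
Qed.

Lemma pairmx_conj (m : nat) (A : 'M[C]_m) x :
  pairmx (A^t*) (rank1 x) = (pairmx A (rank1 x))^*.
Proof.
rewrite /pairmx exchange_big rmorph_sum; apply: eq_bigr => i _.
rewrite rmorph_sum; apply: eq_bigr => j _.
by rewrite !rank1E !mxE !rmorphM /= conjCK; ring.
Qed.

(** [0 <= z] forces z to be real, so A and its adjoint have the same form, and polarization applies
    to their difference. *)
Lemma psdmx_herm (m : nat) (A : 'M[C]_m) : psdmx A -> A^t* = A.
Proof.
move=> /psdmxP A0; apply/subr0_eq/sesqui_eq0 => x.
rewrite pairmxC pairmxDr -scaleN1r pairmxZr !(pairmxC (rank1 x)) pairmx_conj.
by rewrite mulN1r (CrealP (ger0_real (A0 x))) subrr.
Qed.

Lemma rank1_psd (m : nat) (x : 'cV[C]_m) : psdmx (rank1 x).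
Proof.
move=> y; rewrite /rank1 !mulmxA -mulmxA.
have -> : y^t* *m x = (x^t* *m y)^t*.
  by rewrite trmx_mul map_mxM trmxCK.
by rewrite mxE big_ord1 !mxE mulrC mul_conjC_ge0.
Qed.

Lemma psdmx_sum (m : nat) (I : Type) (r : seq I) (f : I -> 'M[C]_m) :
  (forall i, psdmx (f i)) -> psdmx (\sum_(i <- r) f i).
Proof.
move=> f0; apply/psdmxP => x; rewrite pairmxC pairmx_sumr sumr_ge0 // => i _.
by rewrite pairmxC; have /psdmxP := f0 i; apply.
Qed.

Lemma psdmxZ (m : nat) (c : C) (A : 'M[C]_m) :
  0 <= c -> psdmx A -> psdmx (c *: A).
Proof.
move=> c0 /psdmxP A0; apply/psdmxP => x.
by rewrite pairmxC pairmxZr pairmxC mulr_ge0.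
Qed.

Lemma psdmxD (m : nat) (A B : 'M[C]_m) : psdmx A -> psdmx B -> psdmx (A + B).
Proof.
move=> /psdmxP A0 /psdmxP B0; apply/psdmxP => x.
by rewrite pairmxC pairmxDr !(pairmxC (rank1 x)) addr_ge0.
Qed.

Lemma psdmx_trmx (m : nat) (A : 'M[C]_m) : psdmx A -> psdmx A^T.
Proof.
by move=> /psdmxP A0; apply/psdmxP => x; rewrite pairmx_trmx rank1_trmx.
Qed.

Lemma psdmx_spectral (m : nat) (A : 'M[C]_m) : psdmx A ->
  exists y : 'I_m -> 'cV[C]_m, A = \sum_k rank1 (y k).
Proof.
move=> A0; have hA := psdmx_herm A0.
have nA : A \is normalmx by apply/normalmxP; rewrite hA.
have := orthomx_spectralP nA; have := spectral_unitarymx A.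
move: (spectralmx A) (spectral_diag A) => P d unP.
rewrite invmx_unitary // => AE.
have PPt : P *m P^t* = 1%:M by exact/unitarymxP.
have diagE : P *m A *m P^t* = diag_mx d.
  by rewrite AE !mulmxA PPt mul1mx -mulmxA PPt mulmx1.
have d0 k : 0 <= d 0 k.
  pose e : 'cV[C]_m := delta_mx k 0.
  have := A0 (P^t* *m e).
  have -> : (P^t* *m e)^t* *m A *m (P^t* *m e) = e^t* *m (P *m A *m P^t*) *m e.
    by rewrite trmx_mul map_mxM trmxCK !mulmxA.
  by rewrite diagE /e trmx_delta map_delta_mx -rowE -colE !mxE eqxx.
exists (fun k => sqrtC (d 0 k) *: col k (P^t*)).
rewrite [LHS]AE; apply/matrixP => i j; rewrite summxE mxE.
apply: eq_bigr => k _; rewrite rank1Z [in RHS]mxE rank1E mul_mx_diag !mxE conjCK.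
have -> : (sqrtC (d 0 k))^* = sqrtC (d 0 k).
  by apply/CrealP; rewrite ger0_real ?sqrtC_ge0.
by rewrite -expr2 sqrtCK; ring.
Qed.

End Psd.

(** * Choi matrices and the trace form *)

Notation tix i p := (mxtens.mxtens_index (i, p)).

Lemma big_tens (F : nmodType) (k n : nat) (f : 'I_(k * n) -> F) :
  \sum_u f u = \sum_i \sum_p f (tix i p).
Proof.
rewrite pair_bigA (reindex (@mxtens.mxtens_index k n)) /=.
  by apply: eq_bigr => -[i p].
exists (@mxtens.mxtens_unindex k n) => u _;
  [exact: mxtens.mxtens_indexK|exact: mxtens.mxtens_unindexK].
Qed.

Lemma tens_matrixP (F : Type) (k n k' n' : nat) (A B : 'M[F]_(k * n, k' * n')) :
  (forall i p j q, A (tix i p) (tix j q) = B (tix i p) (tix j q)) -> A = B.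
Proof.
move=> AB; apply/matrixP => u v.
rewrite -(mxtens.mxtens_unindexK u) -(mxtens.mxtens_unindexK v).
by case: (mxtens.mxtens_unindex u) (mxtens.mxtens_unindex v) => i p [j q].
Qed.

Lemma pairmx_tens (F : comPzRingType) (k n : nat) (A B : 'M[F]_(k * n)) :
  pairmx A B = \sum_i \sum_p \sum_j \sum_q
    A (tix i p) (tix j q) * B (tix i p) (tix j q).
Proof.
rewrite /pairmx big_tens; apply: eq_bigr => i _; apply: eq_bigr => p _.
exact: big_tens.
Qed.

Section TensorOps.
Variables (F : Type) (n : nat).

(** Conjugation by the flip of the two tensor factors. *)
Definition swapmx (X : 'M[F]_(n * n)) : 'M[F]_(n * n) :=
  \matrix_(u, v) X (tix (mxtens.mxtens_unindex u).2 (mxtens.mxtens_unindex u).1)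
                   (tix (mxtens.mxtens_unindex v).2 (mxtens.mxtens_unindex v).1).

(** The transposed factor is the first one, the input side of a Choi matrix, so this matches
    precomposition with the transpose map. *)
Definition ptranspose (X : 'M[F]_(n * n)) : 'M[F]_(n * n) :=
  \matrix_(u, v) X (tix (mxtens.mxtens_unindex v).1 (mxtens.mxtens_unindex u).2)
                   (tix (mxtens.mxtens_unindex u).1 (mxtens.mxtens_unindex v).2).

Lemma swapmxE X i p j q :
  swapmx X (tix i p) (tix j q) = X (tix p i) (tix q j).
Proof. by rewrite mxE !mxtens.mxtens_indexK. Qed.

Lemma ptransposeE X i p j q :
  ptranspose X (tix i p) (tix j q) = X (tix j p) (tix i q).
Proof. by rewrite mxE !mxtens.mxtens_indexK. Qed.

Lemma swapmxK : involutive swapmx.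
Proof. by move=> X; apply: tens_matrixP => i p j q; rewrite !swapmxE. Qed.

Lemma ptransposeK : involutive ptranspose.
Proof. by move=> X; apply: tens_matrixP => i p j q; rewrite !ptransposeE. Qed.

(** The flip exchanges the two partial transposes, and these differ by the full transpose, which
    preserves positivity. *)
Lemma ptranspose_swapmx X : ptranspose (swapmx X) = (swapmx (ptranspose X))^T.
Proof.
apply: tens_matrixP => i p j q.
by rewrite ptransposeE swapmxE mxE swapmxE ptransposeE.
Qed.

End TensorOps.

Section Maps.
Variables (R : realType) (n : nat).
Local Notation C := R[i].
Local Notation M := 'M[C]_n.
Implicit Types phi psi chi : 'End(M).

Lemma pairmx_swap (A B : 'M[C]_(n * n)) :
  pairmx (swapmx A) B = pairmx A (swapmx B).
Proof.
rewrite !pairmx_tens exchange_big; apply: eq_bigr => i _; apply: eq_bigr => p _.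
rewrite exchange_big; apply: eq_bigr => j _; apply: eq_bigr => q _.
by rewrite !swapmxE.
Qed.

Lemma pairmx_ptranspose (A B : 'M[C]_(n * n)) :
  pairmx (ptranspose A) B = pairmx A (ptranspose B).
Proof.
have E (X Y : 'M[C]_(n * n)) : pairmx X Y = \sum_i \sum_j \sum_p \sum_q
    X (tix i p) (tix j q) * Y (tix i p) (tix j q).
  by rewrite pairmx_tens; apply: eq_bigr => i _; rewrite exchange_big.
rewrite !E exchange_big; do 4!apply: eq_bigr => ? _.
by rewrite !ptransposeE.
Qed.

Lemma swapmx_rank1 (x : 'cV[C]_(n * n)) : exists y, swapmx (rank1 x) = rank1 y.
Proof.
exists (\col_u x (tix (mxtens.mxtens_unindex u).2 (mxtens.mxtens_unindex u).1) 0).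
by apply/matrixP => u v; rewrite mxE !rank1E !mxE.
Qed.

Lemma swapmx_psd (A : 'M[C]_(n * n)) : psdmx A -> psdmx (swapmx A).
Proof.
move=> /psdmxP A0; apply/psdmxP => x; rewrite pairmx_swap.
by have [y ->] := swapmx_rank1 x.
Qed.

Lemma rank1_tens (k : nat) (y : 'cV[C]_k) (x : 'cV[C]_n) i p j q :
  rank1 (y *t x : 'cV[C]_(k * n)) (tix i p) (tix j q) =
    rank1 y i j * rank1 x p q.
Proof.
by rewrite !rank1E !mxE !mxtens.mxtens_indexK /= !(ord1 _) rmorphM /=; ring.
Qed.

Lemma swapmx_rank1_tens (x y : 'cV[C]_n) :
  swapmx (rank1 (y *t x : 'cV[C]_(n * n))) = rank1 (x *t y : 'cV[C]_(n * n)).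
Proof.
by apply: tens_matrixP => i p j q; rewrite swapmxE !rank1_tens mulrC.
Qed.

Lemma pairmx_rank1_tens (k : nat) (X : 'M[C]_(k * n)) (y : 'cV[C]_k)
    (x : 'cV[C]_n) :
  pairmx X (rank1 (y *t x : 'cV[C]_(k * n))) =
    \sum_i \sum_j rank1 y i j * pairmx (tens_block X i j) (rank1 x).
Proof.
rewrite pairmx_tens; apply: eq_bigr => i _.
rewrite exchange_big; apply: eq_bigr => j _; rewrite mulr_sumr.
apply: eq_bigr => p _; rewrite mulr_sumr; apply: eq_bigr => q _.
by rewrite rank1_tens [tens_block _ _ _ _ _]mxE mulrCA.
Qed.

Lemma tens_block_sum_delta (k : nat) (B : 'I_k -> 'I_k -> M) i j :
  tens_block (\sum_(i < k) \sum_(j < k) delta_mx i j *t B i j) i j = B i j.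
Proof.
apply/matrixP => p q; rewrite mxE summxE (bigD1 i) //= summxE (bigD1 j) //=.
rewrite mxtens.tensmxE mxE !eqxx mul1r big1 ?big1 ?addr0 // => l li.
  rewrite summxE big1 // => l' _.
  by rewrite mxtens.tensmxE mxE eq_sym (negPf li) mul0r.
by rewrite mxtens.tensmxE mxE (eq_sym j) (negPf li) andbF mul0r.
Qed.

Lemma tens_block_choi phi i j : tens_block (choi phi) i j = phi (delta_mx i j).
Proof. exact: (tens_block_sum_delta (fun i j => phi (delta_mx i j))). Qed.

Lemma tens_block_ampliation phi (k : nat) (X : 'M[C]_(k * n)) i j :
  tens_block (ampliation phi X) i j = phi (tens_block X i j).
Proof. exact: (tens_block_sum_delta (fun i j => phi (tens_block X i j))). Qed.

Lemma tens_blockP (k : nat) (A B : 'M[C]_(k * n)) :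
  (forall i j, tens_block A i j = tens_block B i j) -> A = B.
Proof.
move=> AB; apply: tens_matrixP => i p j q.
by have /matrixP /(_ p q) := AB i j; rewrite !mxE.
Qed.

Lemma choiE phi i p j q :
  choi phi (tix i p) (tix j q) = phi (delta_mx i j) p q.
Proof. by rewrite -tens_block_choi mxE. Qed.

Lemma lfun_sum_delta phi (X : M) :
  phi X = \sum_i \sum_j X i j *: phi (delta_mx i j).
Proof.
rewrite {1}[X]matrix_sum_delta linear_sum; apply: eq_bigr => i _.
by rewrite linear_sum; apply: eq_bigr => j _; rewrite linearZ.
Qed.

Lemma choi_inj phi psi : choi phi = choi psi -> phi = psi.
Proof.
move=> eq_choi; apply/lfunP => X; rewrite !(lfun_sum_delta _ X).
by do 2!apply: eq_bigr => ? _; rewrite -!tens_block_choi eq_choi.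
Qed.

Definition unchoi_fun (Z : 'M[C]_(n * n)) (X : M) : M :=
  \sum_i \sum_j X i j *: tens_block Z i j.

Fact unchoi_fun_linear Z : linear (unchoi_fun Z).
Proof.
move=> c X Y; rewrite /unchoi_fun scaler_sumr -big_split.
apply: eq_bigr => i _; rewrite scaler_sumr -big_split; apply: eq_bigr => j _.
by rewrite !mxE scalerDl scalerA.
Qed.

HB.instance Definition _ Z :=
  GRing.isLinear.Build C M M *:%R (unchoi_fun Z) (unchoi_fun_linear Z).

Definition unchoi (Z : 'M[C]_(n * n)) : 'End(M) := linfun (unchoi_fun Z).

Lemma choi_unchoi Z : choi (unchoi Z) = Z.
Proof.
apply: tens_blockP => i j; rewrite tens_block_choi lfunE /= /unchoi_fun.
rewrite (bigD1 i) //= (bigD1 j) //= mxE !eqxx scale1r !big1 ?addr0 // => l li.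
  by rewrite big1 // => l' _; rewrite mxE (negPf li) scale0r.
by rewrite mxE (negPf li) andbF scale0r.
Qed.

Lemma choiD phi psi : choi (phi + psi) = choi phi + choi psi.
Proof. by apply: tens_matrixP => i p j q; rewrite !(choiE, mxE) lfunE mxE. Qed.

Lemma choiZ c phi : choi (c *: phi) = c *: choi phi.
Proof. by apply: tens_matrixP => i p j q; rewrite !(choiE, mxE) lfunE mxE. Qed.

(** The trace of [phi] as an endomorphism of the space of matrices, in the basis of matrix units. *)
Definition trl phi : C := \sum_i \sum_j phi (delta_mx i j) i j.

(** The flip appears because the output indices of [psi] are the input indices of [phi]. *)
Lemma trl_comp phi psi :
  trl (phi \o psi)%VF = pairmx (swapmx (choi psi)) (choi phi).
Proof.
rewrite pairmx_tens exchange_big; apply: eq_bigr => i _ /=.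
under eq_bigr do rewrite lfunE /= (lfun_sum_delta phi) summxE.
rewrite exchange_big; apply: eq_bigr => p _ /=.
under eq_bigr do rewrite summxE.
rewrite exchange_big; apply: eq_bigr => q _; apply: eq_bigr => j _ /=.
by rewrite swapmxE !choiE mxE.
Qed.

Lemma trlC phi psi : trl (phi \o psi)%VF = trl (psi \o phi)%VF.
Proof. by rewrite !trl_comp pairmx_swap pairmxC. Qed.

Local Notation CP := (cp_maps R n).
Local Notation CCP := (ccp_maps R n).
Local Notation PPT := (ppt_maps R n).
Local Notation DEC := (dec_maps R n).
Local Notation P1 := (pos_maps R n).
Local Notation SP1 := (sp1_maps R n).
Local Notation tr := (transpose_map R n).

(** The unnormalized maximally entangled vector, the sum of the e_i (x) e_i. *)
Definition omega : 'cV[C]_(n * n) :=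
  \col_u ((mxtens.mxtens_unindex u).1 == (mxtens.mxtens_unindex u).2)%:R.

Lemma tens_block_omega i j : tens_block (rank1 omega) i j = delta_mx i j.
Proof.
apply/matrixP => p q; rewrite !mxE big_ord1 !mxE !mxtens.mxtens_indexK /=.
rewrite conjC_nat (eq_sym p) (eq_sym q).
by case: (i == p); case: (j == q); rewrite /= ?mulr1 ?mulr0.
Qed.

Lemma choi_ampliation phi : choi phi = ampliation phi (rank1 omega).
Proof.
apply: tens_blockP => i j.
by rewrite tens_block_choi tens_block_ampliation tens_block_omega.
Qed.

(** Kraus form: each [xi s], reshaped into a matrix K_s, is a Kraus operator of [phi], and the
    vectors on the right are (1 (x) K_s) chi. *)
Lemma ampliation_rank1 phi (k r : nat) (chi : 'cV[C]_(k * n))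
    (xi : 'I_r -> 'cV[C]_(n * n)) : choi phi = \sum_s rank1 (xi s) ->
  ampliation phi (rank1 chi) = \sum_s rank1
    (\col_u \sum_a chi (tix (mxtens.mxtens_unindex u).1 a) 0 *
                    xi s (tix a (mxtens.mxtens_unindex u).2) 0).
Proof.
move=> choiphi; apply: tens_matrixP => i p j q.
have -> : ampliation phi (rank1 chi) (tix i p) (tix j q) =
    phi (tens_block (rank1 chi) i j) p q.
  by rewrite -tens_block_ampliation mxE.
rewrite lfun_sum_delta summxE [RHS]summxE.
under eq_bigr do rewrite summxE.
under [RHS]eq_bigr do
  rewrite rank1E !mxE !mxtens.mxtens_indexK /= rmorph_sum big_distrlr /=.
rewrite [RHS]exchange_big; apply: eq_bigr => a _ /=.
rewrite [RHS]exchange_big; apply: eq_bigr => b _ /=.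
rewrite mxE [tens_block _ _ _ _ _]mxE rank1E -choiE choiphi summxE mulr_sumr.
by apply: eq_bigr => s _; rewrite rank1E rmorphM /=; ring.
Qed.

(** Choi's theorem: one direction tests [phi] on [omega], the other combines the Kraus form with
    spectral decompositions of the Choi matrix and of the argument. *)
Lemma cp_choi phi : CP phi <-> psdmx (choi phi).
Proof.
split=> [cp_phi|/psdmx_spectral[xi choiphi] k X].
  by rewrite choi_ampliation; apply: cp_phi; exact: rank1_psd.
move=> /psdmx_spectral[chi ->].
have -> : ampliation phi (\sum_s rank1 (chi s)) =
    \sum_s ampliation phi (rank1 (chi s)).
  apply: tens_matrixP => i p j q; rewrite [RHS]summxE.
  have E Y : ampliation phi Y (tix i p) (tix j q) = phi (tens_block Y i j) p q.
    by rewrite -tens_block_ampliation mxE.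
  under [RHS]eq_bigr do rewrite E.
  rewrite E -summxE -linear_sum; congr (phi _ _ _).
  apply/matrixP => a b; rewrite mxE !summxE.
  by apply: eq_bigr => s _; rewrite [RHS]mxE.
apply: psdmx_sum => s; rewrite (ampliation_rank1 _ choiphi).
by apply: psdmx_sum => t; exact: rank1_psd.
Qed.

Lemma cp_comp phi psi : CP phi -> CP psi -> CP (phi \o psi)%VF.
Proof.
move=> cp_phi cp_psi k X /cp_psi /cp_phi.
congr (psdmx _); apply: tens_blockP => i j.
by rewrite !tens_block_ampliation comp_lfunE.
Qed.

Lemma cp1 : CP \1%VF.
Proof.
move=> k X; congr (psdmx _); apply: tens_blockP => i j.
by rewrite tens_block_ampliation id_lfunE.
Qed.

Lemma cpD phi psi : CP phi -> CP psi -> CP (phi + psi).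
Proof. by rewrite !cp_choi choiD; exact: psdmxD. Qed.

Lemma cpZ c phi : 0 <= c -> CP phi -> CP (c *: phi).
Proof. by move=> c0; rewrite !cp_choi choiZ; exact: psdmxZ. Qed.

Lemma transpose_mapE (X : M) : tr X = X^T.
Proof. by rewrite lfunE. Qed.

Lemma transpose_mapK : (tr \o tr = \1)%VF.
Proof. by apply/lfunP => X; rewrite !lfunE /= !transpose_mapE trmxK. Qed.

Lemma choi_comp_transpose phi : choi (phi \o tr)%VF = ptranspose (choi phi).
Proof.
apply: tens_matrixP => i p j q.
by rewrite ptransposeE !choiE comp_lfunE transpose_mapE trmx_delta.
Qed.

(** Transposing both input and output transposes the whole Choi matrix. *)
Lemma cp_transpose_conj phi : CP phi -> CP (tr \o (phi \o tr))%VF.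
Proof.
rewrite !cp_choi => /psdmx_trmx; congr (psdmx _).
apply: tens_matrixP => i p j q; rewrite choiE !comp_lfunE.
by rewrite !transpose_mapE trmx_delta [LHS]mxE [RHS]mxE choiE.
Qed.

Lemma ccpP phi : CCP phi <-> CP (phi \o tr)%VF.
Proof.
split=> [[phi' cp' <-]|cp']; last exists (phi \o tr)%VF => //.
  by rewrite -comp_lfunA transpose_mapK comp_lfun1r.
by rewrite -comp_lfunA transpose_mapK comp_lfun1r.
Qed.

Lemma ccpD phi psi : CCP phi -> CCP psi -> CCP (phi + psi).
Proof. by rewrite !ccpP comp_lfunDl; exact: cpD. Qed.

Lemma ccpZ c phi : 0 <= c -> CCP phi -> CCP (c *: phi).
Proof. by move=> c0; rewrite !ccpP -comp_lfunZl; exact: cpZ. Qed.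

Lemma cp_ccp_comp phi psi : CP phi -> CCP psi -> CCP (phi \o psi)%VF.
Proof. by rewrite !ccpP -comp_lfunA; exact: cp_comp. Qed.

(** Write phi psi = (phi t)(t psi); here t psi = t (psi t) t is a transpose conjugate of a
    completely positive map. *)
Lemma ccp_ccp_comp phi psi : CCP phi -> CCP psi -> CP (phi \o psi)%VF.
Proof.
rewrite !ccpP => cp_phi /cp_transpose_conj cp_psi.
have := cp_comp cp_phi cp_psi; congr (CP _).
rewrite -comp_lfunA (comp_lfunA tr tr) transpose_mapK comp_lfun1l.
by rewrite -comp_lfunA transpose_mapK comp_lfun1r.
Qed.

(** The map psi t is completely copositive, so phi (psi t) is a product of two completely copositive
    maps. *)
Lemma ccp_cp_comp phi psi : CCP phi -> CP psi -> CCP (phi \o psi)%VF.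
Proof.
move=> ccp_phi cp_psi; rewrite ccpP -comp_lfunA.
by apply: ccp_ccp_comp => //; exists psi.
Qed.

Lemma ppt_cp_comp phi psi : PPT phi -> CP psi -> PPT (phi \o psi)%VF.
Proof.
by move=> [cp_phi ccp_phi] cp_psi; split; [exact: cp_comp|exact: ccp_cp_comp].
Qed.

Lemma ppt_ccp_comp phi psi : PPT phi -> CCP psi -> PPT (phi \o psi)%VF.
Proof.
move=> [cp_phi ccp_phi] ccp_psi.
by split; [exact: ccp_ccp_comp|exact: cp_ccp_comp].
Qed.

Lemma pptD phi psi : PPT phi -> PPT psi -> PPT (phi + psi).
Proof. by move=> [? ?] [? ?]; split; [exact: cpD|exact: ccpD]. Qed.

Lemma pptZ c phi : 0 <= c -> PPT phi -> PPT (c *: phi).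
Proof. by move=> c0 [? ?]; split; [exact: cpZ|exact: ccpZ]. Qed.

(** The maps [psi] for which the conclusion holds form a convex set containing CP and CCP, hence
    their hull. *)
Lemma ppt_dec_comp phi psi : PPT phi -> DEC psi -> PPT (phi \o psi)%VF.
Proof.
move=> ppt_phi; apply: (smallest_sub (X := [set psi | PPT (phi \o psi)%VF])).
  move=> x y t; rewrite !inE => px py.
  rewrite /conv /= comp_lfunDr -!comp_lfunZr.
  by apply: pptD; apply: pptZ => //; rewrite /unstable.onem subr_ge0; exact: le1.
by move=> chi [?|?]; [exact: ppt_cp_comp|exact: ppt_ccp_comp].
Qed.

Lemma dec_add phi psi : CP phi -> CCP psi -> DEC (phi + psi).
Proof.
move=> cp_phi ccp_psi A [cvxA sA].
(* phi + psi is the midpoint of 2 phi and 2 psi. *)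
have half_ge0 : 0 <= 2^-1 :> C by rewrite invr_ge0 ler0n.
have half_le1 : 2^-1 <= 1 :> C by rewrite invf_le1 ?ler1n ?ltr0n.
have := cvxA (2 *: phi) (2 *: psi) (Itv01 half_ge0 half_le1).
rewrite !inE /conv /= => /(_ (sA _ _) (sA _ _)).
have -> : unstable.onem 2^-1 = 2^-1 :> C by rewrite /unstable.onem; field.
rewrite !scalerA mulVf ?pnatr_eq0 // !scale1r; apply.
  by left; exact: cpZ.
by right; exact: ccpZ.
Qed.

Lemma choi_id : choi \1%VF = rank1 omega.
Proof.
apply: tens_blockP => i j.
by rewrite tens_block_choi tens_block_omega id_lfunE.
Qed.

(** Composing with the identity, whose Choi matrix is the rank-one matrix of [omega], makes the
    trace a value of the form of the Choi matrix. *)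
Lemma trl_ge0 phi : CP phi -> 0 <= trl phi.
Proof.
move=> /cp_choi /psdmxP phi0; rewrite -[phi]comp_lfun1r trl_comp choi_id.
by have [y ->] := swapmx_rank1 omega; rewrite pairmxC.
Qed.

(** The test map has a flipped rank-one Choi matrix, and its flip cancels the one in [trl_comp]. *)
Lemma cp_of_trl phi : (forall psi, CP psi -> 0 <= trl (phi \o psi)%VF) -> CP phi.
Proof.
move=> phi0; apply/cp_choi/psdmxP => x; rewrite pairmxC.
have := phi0 (unchoi (swapmx (rank1 x))).
rewrite trl_comp choi_unchoi swapmxK; apply; apply/cp_choi.
by rewrite choi_unchoi; apply: swapmx_psd; exact: rank1_psd.
Qed.

Lemma pairmx_choi_tens phi (x y : 'cV[C]_n) :
  pairmx (choi phi) (rank1 (y *t x : 'cV[C]_(n * n))) =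
    pairmx (phi (rank1 y)) (rank1 x).
Proof.
rewrite pairmx_rank1_tens pairmxC lfun_sum_delta pairmx_sumr.
apply: eq_bigr => i _; rewrite pairmx_sumr; apply: eq_bigr => j _.
by rewrite pairmxZr tens_block_choi pairmxC.
Qed.

(** Positivity of a map is block positivity of its Choi matrix, because rank-one arguments suffice
    by the spectral decomposition. *)
Lemma posP phi :
  P1 phi <-> forall x y : 'cV[C]_n,
    0 <= pairmx (choi phi) (rank1 (y *t x : 'cV[C]_(n * n))).
Proof.
split=> [pos_phi x y|pos_phi X /psdmx_spectral[y ->]].
  rewrite pairmx_choi_tens; apply/(proj1 (psdmxP _)).
  by apply: pos_phi; exact: rank1_psd.
rewrite linear_sum; apply: psdmx_sum => k; apply/psdmxP => x.
by rewrite -pairmx_choi_tens.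
Qed.

Lemma cp_pos phi : CP phi -> P1 phi.
Proof. by move=> /cp_choi /psdmxP phi0; apply/posP => x y. Qed.

(** The form is known to be real only on product vectors, so polarization is applied twice: in y for
    fixed x, then in x within each block. *)
Lemma pos_choi_herm phi : P1 phi -> (choi phi)^t* = choi phi.
Proof.
move=> /posP phi0; apply/subr0_eq.
set D := _ - _.
have D0 (x y : 'cV[C]_n) : pairmx D (rank1 (y *t x : 'cV[C]_(n * n))) = 0.
  rewrite pairmxC pairmxDr -scaleN1r pairmxZr !(pairmxC (rank1 _)) pairmx_conj.
  by rewrite mulN1r (CrealP (ger0_real (phi0 x y))) subrr.
apply: tens_blockP => i j.
have -> : tens_block (0 : 'M[C]_(n * n)) i j = 0.
  by apply/matrixP => p q; rewrite !mxE.
apply: sesqui_eq0 => x.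
pose A : M := \matrix_(i, j) pairmx (tens_block D i j) (rank1 x).
suff /matrixP /(_ i j) : A = 0 by rewrite !mxE.
apply: sesqui_eq0 => y; rewrite -[RHS](D0 x y) pairmx_rank1_tens.
rewrite pairmxC; apply: eq_bigr => k _; apply: eq_bigr => l _.
by rewrite [A _ _]mxE.
Qed.

Lemma trl_sp1_pos phi psi : SP1 phi -> P1 psi -> 0 <= trl (phi \o psi)%VF.
Proof.
move=> [k [w [s [ws choiphi]]]] /posP psi0.
rewrite trl_comp choiphi pairmx_sumr sumr_ge0 // => i _.
have [w0 [_ [x [y ->]] <-]] := ws i.
rewrite pairmxZr mulr_ge0 // pairmx_swap.
by rewrite -[_ *m _]/(rank1 (x *t y : 'cV[C]_(n * n))) swapmx_rank1_tens.
Qed.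

End Maps.

(** * Compactness of the generating sets *)

Section ComplexContinuity.
Variables (R : realType) (T : topologicalType).
Local Notation C := R[i].

(** Split into real and imaginary parts, as [hermitian_cone_bipolar] takes it. *)
Definition ccontinuous (f : T -> C) : Prop :=
  continuous (@complex.Re R \o f) /\ continuous (@complex.Im R \o f).

Lemma ccontinuousM (f g : T -> C) :
  ccontinuous f -> ccontinuous g -> ccontinuous (fun p => f p * g p).
Proof.
move=> [cf1 cf2] [cg1 cg2]; split.
  have -> : @complex.Re R \o (fun p => f p * g p) =
      ((@complex.Re R \o f) \* (@complex.Re R \o g)) -
      ((@complex.Im R \o f) \* (@complex.Im R \o g)).
    by apply/funext => p /=; rewrite !fctE /=; case: (f p); case: (g p).
  move=> p; apply: continuousB.
    exact: (continuousM (cf1 p) (cg1 p)).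
  exact: (continuousM (cf2 p) (cg2 p)).
have -> : @complex.Im R \o (fun p => f p * g p) =
    ((@complex.Re R \o f) \* (@complex.Im R \o g)) +
    ((@complex.Im R \o f) \* (@complex.Re R \o g)).
  by apply/funext => p /=; rewrite !fctE /=; case: (f p); case: (g p).
move=> p; apply: continuousD.
  exact: (continuousM (cf1 p) (cg2 p)).
exact: (continuousM (cf2 p) (cg1 p)).
Qed.

Lemma ccontinuousD (f g : T -> C) :
  ccontinuous f -> ccontinuous g -> ccontinuous (fun p => f p + g p).
Proof.
move=> [cf1 cf2] [cg1 cg2]; split.
  have -> : @complex.Re R \o (fun p => f p + g p) =
      (@complex.Re R \o f) + (@complex.Re R \o g).
    by apply/funext => p /=; rewrite !fctE /=; case: (f p); case: (g p).
  by move=> p; apply: continuousD; [exact: cf1|exact: cg1].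
have -> : @complex.Im R \o (fun p => f p + g p) =
    (@complex.Im R \o f) + (@complex.Im R \o g).
  by apply/funext => p /=; rewrite !fctE /=; case: (f p); case: (g p).
by move=> p; apply: continuousD; [exact: cf2|exact: cg2].
Qed.

Lemma ccontinuousJ (f : T -> C) :
  ccontinuous f -> ccontinuous (fun p => (f p)^*).
Proof.
move=> [cf1 cf2]; split.
  have -> // : @complex.Re R \o (fun p => (f p)^*) = @complex.Re R \o f.
  by apply/funext => p /=; case: (f p).
have -> : @complex.Im R \o (fun p => (f p)^*) = - (@complex.Im R \o f).
  by apply/funext => p /=; rewrite !fctE /=; case: (f p).
by move=> p; apply: continuousN; exact: cf2.
Qed.

Lemma ccontinuous_rank1 (m : nat) (f : T -> 'cV[C]_m) :
  (forall i, ccontinuous (fun p => f p i 0)) ->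
  forall i j, ccontinuous (fun p => rank1 (f p) i j).
Proof.
move=> cf i j.
have -> : (fun p => rank1 (f p) i j) = (fun p => f p i 0 * (f p j 0)^*).
  by apply/funext => p; rewrite rank1E.
by apply: ccontinuousM => //; exact: ccontinuousJ.
Qed.

End ComplexContinuity.

Lemma ccontinuous_comp (R : realType) (U T : topologicalType)
    (g : U -> T) (f : T -> R[i]) :
  continuous g -> ccontinuous f -> ccontinuous (fun p => f (g p)).
Proof.
move=> cg [cf1 cf2]; rewrite /ccontinuous; split=> p.
  exact: (@continuous_comp _ _ _ g (@complex.Re R \o f) _ (cg p) (cf1 (g p))).
exact: (@continuous_comp _ _ _ g (@complex.Im R \o f) _ (cg p) (cf2 (g p))).
Qed.

Section Sphere.
Variable R : realType.
Local Notation C := R[i].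

Definition sphere (m : nat) : set 'rV[R]_m := [set p | dot p p = 1].

Definition cvec (d : nat) (p : 'rV[R]_(d + d)) : 'cV[C]_d :=
  \col_i Complex (p 0 (lshift d i)) (p 0 (rshift d i)).

Lemma sphere_compact (m : nat) : compact (sphere (m := m)).
Proof.
pose box := [set v : 'rV[R]_m | forall i, `[-1, 1]%classic (v ord0 i)].
have cbox : compact box.
  apply: (@rV_compact R m (fun=> `[-1, 1]%classic)) => i.
  exact: segment_compact.
apply: subclosed_compact cbox _.
  have cdot : continuous (fun p : 'rV[R]_m => dot p p).
    have cc i : continuous (fun p : 'rV[R]_m => p 0 i) by exact: coord_continuous.
    by apply: continuous_sumr => i p; exact: (continuousM (cc i p) (cc i p)).
  have := proj1 (continuous_closedP _) cdot [set y | y = 1].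
  by apply; exact: closed_eq.
move=> p /= p1 i; rewrite /= in_itv /= -ler_norml -(expr_le1 (n := 2)) //.
rewrite real_normK ?num_real // -p1 /dot (bigD1 i) //= -expr2 lerDl.
by apply: sumr_ge0 => j _; exact: sqr_ge0.
Qed.

Lemma cvec_ccontinuous (d : nat) (i : 'I_d) :
  ccontinuous (fun p : 'rV[R]_(d + d) => cvec p i 0).
Proof.
split.
  have -> : @complex.Re R \o (fun p : 'rV[R]_(d + d) => cvec p i 0) =
    (fun p => p 0 (lshift d i)) by apply/funext => p /=; rewrite mxE.
  exact: coord_continuous.
have -> : @complex.Im R \o (fun p : 'rV[R]_(d + d) => cvec p i 0) =
  (fun p => p 0 (rshift d i)) by apply/funext => p /=; rewrite mxE.
exact: coord_continuous.
Qed.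

Lemma trace_rank1_cvec (d : nat) (p : 'rV[R]_(d + d)) :
  \tr (rank1 (cvec p)) = (dot p p)%:C%C.
Proof.
rewrite /dot big_split_ord /= -big_split rmorph_sum; apply: eq_bigr => i _ /=.
rewrite rank1E !mxE conjCE /=.
by apply/eqP; rewrite eq_complex /=; apply/andP; split; apply/eqP; ring.
Qed.

(** This extends nonnegativity from unit vectors to all vectors by homogeneity. Zero is separate
    because the sphere is empty for d = 0. *)
Lemma cvec_polar (d : nat) (x : 'cV[C]_d) :
  x = 0 \/ exists (c : C) p, sphere p /\ x = c *: cvec p.
Proof.
pose q : 'rV[R]_(d + d) := 
  row_mx (\row_i complex.Re (x i 0)) (\row_i complex.Im (x i 0)).
have xE : x = cvec q.
  apply/colP => i; rewrite mxE row_mxEl row_mxEr !mxE.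
  by case: (x i 0).
have [q0|q0] := leP (dot q q) 0; [left|right].
  rewrite xE (dot_eq0 q0); apply/colP => i; rewrite !mxE //.
pose r := Num.sqrt (dot q q).
have r_neq0 : r != 0 by rewrite gt_eqF // sqrtr_gt0.
exists r%:C%C, (r^-1 *: q); split.
  rewrite /sphere /= dotZr dotC dotZr mulrA -expr2 exprVn sqr_sqrtr ?(ltW q0) //.
  by rewrite mulVf // gt_eqF.
rewrite xE; apply/colP => i; rewrite !mxE.
by apply/eqP; rewrite eq_complex /=; apply/andP; split; apply/eqP; field.
Qed.

End Sphere.

Lemma tensmxZ (F : comPzRingType) (m n p q : nat) (c d : F)
    (A : 'M[F]_(m, n)) (B : 'M[F]_(p, q)) :
  (c *: A) *t (d *: B) = (c * d) *: (A *t B).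
Proof. by apply/matrixP => i j; rewrite !mxE; ring. Qed.

Section PtransposeLinear.
Variables (F : comPzRingType) (n : nat).
Implicit Types X Y : 'M[F]_(n * n).

Lemma ptransposeZ c X : ptranspose (c *: X) = c *: ptranspose X.
Proof. by apply/matrixP => u v; rewrite !mxE. Qed.

Lemma ptranspose_sum (I : Type) (r : seq I) (f : I -> 'M[F]_(n * n)) :
  ptranspose (\sum_(i <- r) f i) = \sum_(i <- r) ptranspose (f i).
Proof.
apply/matrixP => u v; rewrite mxE !summxE.
by apply: eq_bigr => i _; rewrite mxE.
Qed.

Lemma mxtrace_ptranspose X : \tr (ptranspose X) = \tr X.
Proof.
rewrite /mxtrace !big_tens; apply: eq_bigr => i _; apply: eq_bigr => p _.
by rewrite ptransposeE.
Qed.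

End PtransposeLinear.

(** * The two duality inclusions that rest on compactness *)

Section Duality.
Variables (R : realType) (n : nat).
Local Notation C := R[i].
Local Notation M := 'M[C]_n.
Local Notation PPT := (ppt_maps R n).
Local Notation DEC := (dec_maps R n).
Local Notation P1 := (pos_maps R n).
Local Notation SP1 := (sp1_maps R n).
Implicit Types phi psi : 'End(M).

Lemma sp1_of_trl phi : (choi phi)^t* = choi phi ->
  (forall psi, P1 psi -> 0 <= trl (phi \o psi)%VF) -> SP1 phi.
Proof.
move=> hphi phi0.
pose prodv (p : 'rV[R]_(n + n) * 'rV[R]_(n + n)) : 'cV[C]_(n * n) :=
  cvec p.1 *t cvec p.2.
have cprod u v : ccontinuous (fun p => rank1 (prodv p) u v).
  apply: ccontinuous_rank1 => l.
  have -> : (fun p => prodv p l 0) =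
      (fun p => cvec p.1 (mxtens.mxtens_unindex l).1 0 *
                cvec p.2 (mxtens.mxtens_unindex l).2 0).
    by apply/funext => p; rewrite mxE !(ord1 _).
  apply: ccontinuousM.
    apply: (ccontinuous_comp (f := fun p => cvec p _ 0));
      last exact: cvec_ccontinuous.
    by move=> p; exact: cvg_fst.
  apply: (ccontinuous_comp (f := fun p => cvec p _ 0));
      last exact: cvec_ccontinuous.
  by move=> p; exact: cvg_snd.
have [|||||H H0|k [w [s [ws choiphi]]]] := @hermitian_cone_bipolar R
    _ _ (@sphere R (n + n) `*` @sphere R (n + n)) (fun p => rank1 (prodv p))
    (choi phi) (compact_setX (@sphere_compact _ _) (@sphere_compact _ _)).
- by move=> u v; have [] := cprod u v.
- by move=> u v; have [] := cprod u v.
- by move=> p; exact: rank1_herm.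
- move=> [p q] [/= p1 q1]; rewrite /mxtrace big_tens.
  under eq_bigr do under eq_bigr do rewrite rank1_tens.
  rewrite -big_distrlr -!/(mxtrace _) /= !trace_rank1_cvec p1 q1.
  by rewrite mulr1.
- exact: hphi.
(* A functional nonnegative on unit product vectors is, after a flip, the Choi matrix of a positive
   map, to which the hypothesis applies. *)
- pose psi := unchoi (swapmx H).
  have := phi0 psi; rewrite trl_comp choi_unchoi swapmxK; apply.
  apply/posP => x y; rewrite choi_unchoi pairmx_swap swapmx_rank1_tens.
  have [->|[c [p [p1 ->]]]] := cvec_polar x.
    by rewrite mxtens.tens0mx rank1_0 pairmx0r.
  have [->|[d [q [q1 ->]]]] := cvec_polar y.
    by rewrite mxtens.tensmx0 rank1_0 pairmx0r.
  rewrite tensmxZ rank1Z pairmxZr mulr_ge0 ?mul_conjC_ge0 //.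
  exact: (H0 (p, q)).
exists k, w, (fun i => rank1 (prodv (s i))); split => // i.
have [w0 _] := ws i; split => //; exists (prodv (s i)) => //.
by exists (cvec (s i).1), (cvec (s i).2).
Qed.

Lemma dec_of_trl phi : (choi phi)^t* = choi phi ->
  (forall psi, PPT psi -> 0 <= trl (phi \o psi)%VF) -> DEC phi.
Proof.
move=> hphi phi0.
pose N := (n * n)%N.
(* The two halves of one vector feed the CP and CCP generators, so a single sphere parametrizes both
   kinds and fixes the total trace at 1. *)
pose g (z : 'cV[C]_(N + N)) : 'M[C]_N :=
  rank1 (usubmx z) + ptranspose (rank1 (dsubmx z)).
have gZ c z : g (c *: z) = (c * c^*) *: g z.
  by rewrite /g !linearZ /= !rank1Z ptransposeZ scalerDr.
have cg u v : ccontinuous (fun p : 'rV[R]_((N + N) + (N + N)) => g (cvec p) u v).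
  have -> : (fun p : 'rV[R]_((N + N) + (N + N)) => g (cvec p) u v) = (fun p =>
      rank1 (usubmx (cvec p)) u v + rank1 (dsubmx (cvec p))
       (tix (mxtens.mxtens_unindex v).1 (mxtens.mxtens_unindex u).2)
       (tix (mxtens.mxtens_unindex u).1 (mxtens.mxtens_unindex v).2)).
    by apply/funext => p; rewrite /g mxE [ptranspose _ _ _]mxE.
  apply: ccontinuousD; apply: ccontinuous_rank1 => l.
    have -> : (fun p : 'rV[R]_((N + N) + (N + N)) => usubmx (cvec p) l 0) =
      (fun p => cvec p (lshift N l) 0) by apply/funext => p; rewrite mxE.
    exact: cvec_ccontinuous.
  have -> : (fun p : 'rV[R]_((N + N) + (N + N)) => dsubmx (cvec p) l 0) =
    (fun p => cvec p (rshift N l) 0) by apply/funext => p; rewrite mxE.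
  exact: cvec_ccontinuous.
have [|||||H H0|k [w [s [ws choiphi]]]] := @hermitian_cone_bipolar R
    _ N (@sphere R ((N + N) + (N + N))) (fun p => g (cvec p))
    (choi phi) (@sphere_compact _ _).
- by move=> u v; have [] := cg u v.
- by move=> u v; have [] := cg u v.
- move=> p; rewrite /g linearD /= map_mxD; congr (_ + _); first exact: rank1_herm.
  rewrite -[X in _ = ptranspose X]rank1_herm.
  by apply/matrixP => u v; rewrite !mxE.
- move=> p p1; rewrite /g linearD /= mxtrace_ptranspose.
  have -> : \tr (rank1 (usubmx (cvec p))) + \tr (rank1 (dsubmx (cvec p))) =
      \tr (rank1 (cvec p)).
    rewrite {3}/mxtrace big_split_ord; congr (_ + _);
      by apply: eq_bigr => i _; rewrite !rank1E !mxE.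
  by rewrite trace_rank1_cvec p1.
- exact: hphi.
- pose psi := unchoi (swapmx H).
  have := phi0 psi; rewrite trl_comp choi_unchoi swapmxK; apply.
  have Hg z : 0 <= pairmx H (g z).
    have [->|[c [p [p1 ->]]]] := cvec_polar z.
      by rewrite -(scale0r (0 : 'cV[C]_(N + N))) gZ mul0r scale0r pairmx0r.
    by rewrite gZ pairmxZr mulr_ge0 ?mul_conjC_ge0 //; exact: H0.
  (* Vectors with lower half zero show that H is positive semidefinite, those with upper half zero
     that its partial transpose is. *)
  split.
    apply/cp_choi; rewrite choi_unchoi; apply: swapmx_psd; apply/psdmxP => x.
    have := Hg (col_mx x 0); rewrite /g col_mxKu col_mxKd rank1_0.
    by rewrite -(scale0r (0 : 'M[C]_N)) ptransposeZ scale0r addr0.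
  apply/ccpP/cp_choi; rewrite choi_comp_transpose choi_unchoi.
  rewrite ptranspose_swapmx; apply/psdmx_trmx/swapmx_psd/psdmxP => y.
  have := Hg (col_mx 0 y); rewrite /g col_mxKu col_mxKd rank1_0 add0r.
  by rewrite pairmx_ptranspose.
pose a i := usubmx (cvec (s i)); pose b i := dsubmx (cvec (s i)).
have -> : phi = unchoi (\sum_i w i *: rank1 (a i)) +
    unchoi (ptranspose (\sum_i w i *: rank1 (b i))).
  apply: choi_inj; rewrite choiD !choi_unchoi choiphi ptranspose_sum -big_split.
  by apply: eq_bigr => i _ /=; rewrite ptransposeZ -scalerDr.
apply: dec_add.
  apply/cp_choi; rewrite choi_unchoi; apply: psdmx_sum => i.
  by apply: psdmxZ; [have [] := ws i|exact: rank1_psd].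
apply/ccpP/cp_choi; rewrite choi_comp_transpose choi_unchoi ptransposeK.
apply: psdmx_sum => i.
by apply: psdmxZ; [have [] := ws i|exact: rank1_psd].
Qed.

End Duality.

Theorem theorem5p2 (R : realType) (n : nat) :
  let P1 := pos_maps R n in
  let CP := cp_maps R n in
  let PPT := ppt_maps R n in
  let DEC := dec_maps R n in
  let SP1 := sp1_maps R n in
  [<-> PPT ∘ PPT `<=` SP1;
       PPT ∘ P1 `<=` DEC;
       P1 ∘ PPT `<=` DEC;
       PPT ∘ CP ∘ PPT `<=` SP1;
       PPT ∘ DEC ∘ PPT `<=` SP1;
       PPT ∘ P1 ∘ PPT `<=` CP;
       PPT ∘ P1 ∘ PPT `<=` PPT].
Proof.
move=> P1 CP PPT DEC SP1.
have ppt_cp phi : PPT phi -> CP phi by case.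
have herm_comp phi psi : P1 phi -> P1 psi ->
    (choi (phi \o psi)%VF)^t* = choi (phi \o psi)%VF.
  move=> pos_phi pos_psi; apply: pos_choi_herm => X /pos_psi /pos_phi.
  by rewrite comp_lfunE.
have ppt_pos phi : PPT phi -> P1 phi by move=> /ppt_cp; exact: cp_pos.
have ppt_comp phi psi : PPT phi -> PPT psi -> PPT (phi \o psi)%VF.
  by move=> ppt_phi /ppt_cp; exact: ppt_cp_comp.
have trl_ppt_dec phi psi : PPT phi -> DEC psi -> 0 <= trl (phi \o psi)%VF.
  by move=> ppt_phi /(ppt_dec_comp ppt_phi) /ppt_cp; exact: trl_ge0.
tfae.
(* Rotate Tr (phi psi chi) to Tr ((chi phi) psi). *)
- move=> sp1 _ [phi ppt_phi [psi pos_psi <-]].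
  apply: dec_of_trl; first exact: herm_comp (ppt_pos _ ppt_phi) pos_psi.
  move=> chi ppt_chi; rewrite trlC comp_lfunA; apply: trl_sp1_pos => //.
  by apply: sp1; exists chi => //; exists phi.
- move=> dec _ [psi pos_psi [phi ppt_phi <-]].
  (* Changing the side of the positive map goes back through the first inclusion: Tr (phi (chi
     psi')) pairs PPT with DEC. *)
  have sp1 chi : PPT chi -> SP1 (phi \o chi)%VF.
    move=> ppt_chi; apply: sp1_of_trl; first by apply: herm_comp; exact: ppt_pos.
    move=> psi' pos_psi'; rewrite -comp_lfunA; apply: trl_ppt_dec => //.
    by apply: dec; exists chi => //; exists psi'.
  apply: dec_of_trl; first exact: herm_comp pos_psi (ppt_pos _ ppt_phi).
  move=> chi ppt_chi; rewrite -comp_lfunA trlC.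
  by apply: trl_sp1_pos; [exact: sp1|].
(* Absorb c into phi, then rotate to Tr (chi (psi (phi c))), which pairs PPT with DEC. *)
- move=> dec _ [_ [phi ppt_phi [c cp_c <-]] [chi ppt_chi <-]].
  have ppt_phic : PPT (phi \o c)%VF by exact: ppt_cp_comp.
  apply: sp1_of_trl; first by apply: herm_comp; exact: ppt_pos.
  move=> psi pos_psi; rewrite trlC comp_lfunA trlC; apply: trl_ppt_dec => //.
  by apply: dec; exists psi => //; exists (phi \o c)%VF.
(* Absorb d into phi and take the identity as the completely positive middle factor. *)
- move=> sp1 _ [_ [phi ppt_phi [d dec_d <-]] [chi ppt_chi <-]].
  apply: sp1; exists (phi \o d)%VF; last by exists chi.
  exists (phi \o d)%VF; first exact: ppt_dec_comp.
  by exists \1%VF; [exact: cp1|rewrite comp_lfun1r].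
(* By self-duality of CP, test against c and rotate to Tr ((chi c phi) psi), with c regarded as
   decomposable. *)
- move=> sp1 _ [_ [phi ppt_phi [psi pos_psi <-]] [chi ppt_chi <-]].
  apply: cp_of_trl => c cp_c.
  rewrite -!comp_lfunA trlC -comp_lfunA trlC; apply: trl_sp1_pos => //.
  apply: sp1; exists (chi \o c)%VF; last by exists phi.
  by exists chi => //; exists c => //; apply: sub_gen_smallest; left.
- move=> cp _ [_ [phi ppt_phi [psi pos_psi <-]] [chi ppt_chi <-]]; split.
    apply: cp; exists (phi \o psi)%VF; last by exists chi.
    by exists phi => //; exists psi.
  (* The transpose moves into chi: chi t is again PPT, since composing with t exchanges CP and
     CCP. *)
  apply/ccpP; rewrite -(comp_lfunA _ _ (transpose_map R n)).
  apply: cp; exists (phi \o psi)%VF; first by exists phi => //; exists psi.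
  exists (chi \o transpose_map R n)%VF => //.
  have [cp_chi ccp_chi] := ppt_chi; split; first exact/ccpP.
  by apply/ccpP; rewrite -comp_lfunA transpose_mapK comp_lfun1r.
(* Rotate Tr (phi chi psi) to Tr (chi psi phi), the trace of a completely positive map. *)
- move=> ppt _ [phi ppt_phi [chi ppt_chi <-]].
  apply: sp1_of_trl; first by apply: herm_comp; exact: ppt_pos.
  move=> psi pos_psi; rewrite -comp_lfunA trlC.
  apply/trl_ge0/ppt_cp/ppt; exists (chi \o psi)%VF; last by exists phi.
  by exists chi => //; exists psi.
Qed.
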